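(* Let $A\subseteq\mathbb{R}$ be an open invex set with respect to a function $\eta:A\times A\to\mathbb{R}$, and suppose $\eta$ satisfies Condition C. Let $a,b\in A$ with $a<a+\eta(b,a)$. Let $f:A\to(0,\infty)$ be preinvex on $A$ with respect to $\eta$, with $f$ Lebesgue integrable on $[a,a+\eta(b,a)]$. Then for every $\alpha>0$, \[ f\left(\frac{2a+\eta(b,a)}{2}\right)\le \frac{\Gamma(\alpha+1)}{2\eta^{\alpha}(b,a)}\Big[J_{a^+}^{\alpha}f\big(a+\eta(b,a)\big)+J_{(a+\eta(b,a))^-}^{\alpha}f(a)\Big]\le \frac{f(a)+f(a+\eta(b,a))}{2}\le\frac{f(a)+f(b)}{2}. \]
   Context: A set $A\subseteq\mathbb{R}$ is invex with respect to $\eta:A\times A\to\mathbb{R}$ if $x+t\eta(y,x)\in A$ for all $x,y\in A$ and $t\in[0,1]$. A function $f$ on an invex set $A$ is preinvex with respect to $\eta$ if $f(x+t\eta(y,x))\le(1-t)f(x)+tf(y)$ for all $x,y\in A$, $t\in[0,1]$. Condition C: for all $x,y\in A$ and $t\in[0,1]$, $\eta(y,y+t\eta(x,y))=-t\eta(x,y)$ and $\eta(x,y+t\eta(x,y))=(1-t)\eta(x,y)$. For $g\in L[c,d]$ and $\alpha>0$, the Riemann–Liouville fractional integrals are $J_{c^+}^{\alpha}g(x)=\frac{1}{\Gamma(\alpha)}\int_c^x(x-t)^{\alpha-1}g(t)\,dt$ for $x>c$ and $J_{d^-}^{\alpha}g(x)=\frac{1}{\Gamma(\alpha)}\int_x^d(t-x)^{\alpha-1}g(t)\,dt$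 for $x<d$; here $\eta^{\alpha}(b,a)$ means $(\eta(b,a))^{\alpha}$. *)

(* Defs.v *)
From HB Require Import structures.
From mathcomp Require Import all_boot all_order all_algebra.
From mathcomp Require Import all_classical all_reals all_analysis.
Set Implicit Arguments. Unset Strict Implicit. Unset Printing Implicit Defensive.
Import Order.TTheory GRing.Theory Num.Theory.
Import numFieldNormedType.Exports.
Local Open Scope classical_set_scope.
Local Open Scope ring_scope.

Section Defs.
Variable R : realType.
Notation mu := (@lebesgue_measure R).

Definition invex (A : set R) (eta : R -> R -> R) : Prop :=
  forall x y, A x -> A y -> forall t : R, 0 <= t <= 1 -> A (x + t * eta y x).

Definition preinvex (A : set R) (eta : R -> R -> R) (f : R -> R) : Prop :=
  forall x y, A x -> A y -> forall t : R, 0 <= t <= 1 ->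
    f (x + t * eta y x) <= (1 - t) * f x + t * f y.

Definition conditionC (A : set R) (eta : R -> R -> R) : Prop :=
  forall x y, A x -> A y -> forall t : R, 0 <= t <= 1 ->
    eta y (y + t * eta x y) = - (t * eta x y) /\
    eta x (y + t * eta x y) = (1 - t) * eta x y.

Definition Gamma (alpha : R) : R :=
  Rintegral mu `[0, +oo[ (fun t => t `^ (alpha - 1) * expR (- t)).

Definition RL_left (alpha c : R) (g : R -> R) (x : R) : R :=
  (Gamma alpha)^-1 * Rintegral mu `[c, x] (fun t => (x - t) `^ (alpha - 1) * g t).

Definition RL_right (alpha d : R) (g : R -> R) (x : R) : R :=
  (Gamma alpha)^-1 * Rintegral mu `[x, d] (fun t => (t - x) `^ (alpha - 1) * g t).

End Defs.

(* Main.v *)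
(** Condition C makes [eta] behave like subtraction along the segment
    [a, a + eta b a], so preinvexity gives there the chord inequality and
    midpoint convexity at points symmetric about the centre.  Reflecting the
    right-sided integral turns the sum of the two fractional integrals into the
    integral of [(d - t)^(alpha - 1) * (f t + f (a + d - t))], with
    [d = a + eta b a], whose second factor lies between [2 f((a + d) / 2)] and
    [f a + f d].  The constant simplifies by the functional equation
    [Gamma (alpha + 1) = alpha * Gamma alpha], which follows from Tonelli on
    [0 <= s <= t] without any integrability; finiteness of [Gamma] is then an
    induction from the case [alpha <= 1]. *)
Require Import Defs.
From HB Require Import structures.
From mathcomp Require Import all_boot all_order all_algebra.
From mathcomp Require Import all_classical all_reals all_analysis.
From mathcomp Require Import measurable_realfun ring lra.
Import Order.TTheory GRing.Theory Num.Theory.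
Import numFieldNormedType.Exports.
Local Open Scope classical_set_scope.
Local Open Scope ring_scope.

(** * Invariance of Lebesgue integrals under reflection *)

Lemma measurable_reflection {R : realType} (c : R) :
  measurable_fun [set: R] (fun x => c - x).
Proof. by apply: measurable_funB. Qed.

(** By uniqueness of Lebesgue measure it suffices to compare both sides on half-open intervals.
    Reflection moves the open end to the other side but preserves the length. *)
Lemma lebesgue_measure_reflection {R : realType} (c : R) (D : set R) :
  measurable D ->
  pushforward lebesgue_measure ((fun x => c - x) : R -> measurableTypeR R) D =
  lebesgue_measure D.
Proof.
move=> mD; apply/esym/lebesgue_measure_unique => //=.
  exact: measurable_reflection.
move=> mphi _ [[p q] _ <-]; rewrite /pushforward.
rewrite (_ : _ @^-1` _ = `[c - q, c - p[%classic); last first.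
  apply/seteqP; split => x /=; rewrite !in_itv/= => /andP[]; lra.
rewrite !lebesgue_measure_itv /= !lte_fin ltrD2l ltrN2.
by case: ifPn => // _; rewrite -!EFinB; congr EFin; lra.
Qed.

Lemma ge0_integral_reflection {R : realType} (c : R) (D : set R)
    (f : R -> \bar R) :
  measurable D -> measurable_fun D f -> (forall x, D x -> 0 <= f x)%E ->
  (\int[lebesgue_measure]_(x in D) f x =
   \int[lebesgue_measure]_(x in (fun x => (c - x)%R) @^-1` D) f (c - x)%R)%E.
Proof.
move=> mD mf f0.
rewrite -(@ge0_integral_pushforward _ _ (measurableTypeR R) (measurableTypeR R)
  R _ (measurable_reflection c) lebesgue_measure D f mD mf); last first.
  by move=> y; rewrite inE; exact: f0.
apply: eq_measure_integral => [|mphi B mB _].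
  exact: measurable_reflection.
exact/esym/lebesgue_measure_reflection.
Qed.

Lemma ge0_integral_reflection_itv {R : realType} (a d : R) (f : R -> \bar R) :
  measurable_fun `[a, d] f -> (forall x, x \in `[a, d] -> 0 <= f x)%E ->
  (\int[lebesgue_measure]_(x in `[a, d]) f x =
   \int[lebesgue_measure]_(x in `[a, d]) f (a + d - x)%R)%E.
Proof.
move=> mf f0; rewrite (ge0_integral_reflection (a + d)) //.
congr integral; apply/seteqP; split => x /=; rewrite !in_itv/= => /andP[]; lra.
Qed.

(** * Integrals of power functions near 0 *)

Lemma is_derive1_powR_div {R : realType} (p x : R) : p != 0 -> 0 < x ->
  is_derive x 1 (fun t : R => t `^ p / p) (x `^ (p - 1)).
Proof.
move=> p0 x0.
have dp : is_derive x 1 (fun t : R => t `^ p) _ := is_derive1_powR p x0.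
have -> : (fun t : R => t `^ p / p) = p^-1 \*: (fun t : R => t `^ p).
  by apply/funext => t /=; rewrite mulrC.
by apply: is_derive_eq; rewrite scalerA mulVf// scale1r.
Qed.

Lemma continuous_powR {R : realType} (p x : R) : 0 < x ->
  {for x, continuous (fun t : R => t `^ p)}.
Proof.
move=> x0; apply: differentiable_continuous; apply/derivable1_diffP.
by apply: derivable_powR; rewrite in_itv/= x0.
Qed.

Lemma integral_powRB1 {R : realType} (p x : R) : 0 < p -> 0 <= x ->
  (\int[lebesgue_measure]_(t in `[0%R, x]) (t `^ (p - 1))%:E =
   (x `^ p / p)%:E)%E.
Proof.
move=> p0; rewrite le_eqVlt => /predU1P[<-|x0].
  by rewrite set_itv1 integral_set1 powR0 ?mul0r ?gt_eqF.
(* The integrand is unbounded at 0 when p < 1, hence the cutoff. *)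
pose F (n : nat) : set R := `[n.+1%:R^-1, x]%classic.
have FE : \bigcup_n F n = `]0, x]%classic.
  apply/seteqP; split => [t [n _]|t] /=;
    rewrite /F /= !in_itv/= => /andP[nt tx].
    by rewrite tx (lt_le_trans _ nt).
  (* The integer part [n] of 1/t satisfies 1/t < n + 1, so the cutoff 1/(n + 1) lies below [t]. *)
  exists (Num.truncn t^-1) => //=; rewrite in_itv/= tx andbT.
  by rewrite -[leRHS]invrK lef_pV2 ?posrE ?invr_gt0// ltW// truncnS_gt.
have mh (D : set R) : measurable_fun D (fun t : R => (t `^ (p - 1))%:E).
  by apply/measurable_EFinP; apply: measurable_funTS; exact: measurable_powR.
(* The cutoffs exhaust only []0, x]]; the missing endpoint 0 is a null set. *)
rewrite -integral_itv_obnd_cbnd// -FE.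
have cvF : (\int[lebesgue_measure]_(t in F n) (t `^ (p - 1))%:E)%E
    @[n --> \oo] -->
    (\int[lebesgue_measure]_(t in \bigcup_n F n) (t `^ (p - 1))%:E)%E.
  apply: ge0_nondecreasing_set_cvg_integral => //.
  - apply/nondecreasing_seqP => n; rewrite subsetEset => t.
    rewrite /F /= !in_itv/= => /andP[nt ->]; rewrite andbT (le_trans _ nt)//.
    by rewrite lef_pV2 ?posrE// ler_nat.
  - by move=> n; exact: measurable_itv.
  - by move=> n; exact: mh.
  - by move=> n t _; rewrite lee_fin powR_ge0.
rewrite -(cvg_lim _ cvF)//.
apply/cvg_lim => //.
(* The boundary term at the cutoff vanishes in the limit because [0 < p]. *)
have cvgp : ((x `^ p / p)%:E - ((n.+1%:R^-1 `^ p) / p)%:E)%E @[n --> \oo] -->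
    (x `^ p / p)%:E.
  rewrite -[X in _ --> X]sube0; apply: cvgeB => //; first exact: cvg_cst.
  apply: cvg_EFin; first by near=> n.
  rewrite -[X in _ --> X](mul0r p^-1).
  apply: cvgMr_tmp; have /cvg_at_rightP := powR_cvg0 p0; apply; split => //.
  exact: cvg_harmonic.
(* The fundamental theorem of calculus is applied only for large [n], once the cutoff is below
   [x]. *)
apply: cvg_trans cvgp; apply: near_eq_cvg; near=> n.
have nx : n.+1%:R^-1 < x :> R.
  near: n; exact: near_infty_natSinv_lt (PosNum x0).
have n0 : 0 < n.+1%:R^-1 :> R by [].
have pN0 : p != 0 by rewrite gt_eqF.
rewrite (@continuous_FTC2 R _ (fun t => t `^ p / p))//.
- apply: continuous_in_subspaceT => t; rewrite inE/= in_itv/= => /andP[nt _].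
  by apply: continuous_powR; rewrite (lt_le_trans n0).
- split.
  + move=> t; rewrite in_itv/= => /andP[nt _].
    by apply: ex_derive; apply: is_derive1_powR_div; rewrite // (lt_trans n0).
  + apply: cvg_at_right_filter; apply: cvgMr_tmp; exact: continuous_powR.
  + apply: cvg_at_left_filter; apply: cvgMr_tmp; exact: continuous_powR.
- move=> t; rewrite in_itv/= => /andP[nt _].
  have t0 := lt_trans n0 nt; have dt := is_derive1_powR_div p t pN0 t0.
  by rewrite derive1E derive_val.
Unshelve. all: end_near.
Qed.

(** * The Gamma integral: recurrence, finiteness, positivity *)

Lemma measurable_expRN {R : realType} (D : set R) :
  measurable_fun D (fun t : R => expR (- t)).
Proof. by apply: measurable_funTS; exact: measurableT_comp. Qed.

Lemma measurable_powR_expRN {R : realType} (q : R) (D : set R) :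
  measurable_fun D (fun t : R => (t `^ q * expR (- t))%:E).
Proof.
apply/measurable_EFinP; apply: measurable_funM; last exact: measurable_expRN.
by apply: measurable_funTS; exact: measurable_powR.
Qed.

Lemma powR_expRN_ge0 {R : realType} (q t : R) :
  (0 <= (t `^ q * expR (- t))%:E)%E.
Proof. by rewrite lee_fin mulr_ge0 ?powR_ge0 ?expR_ge0. Qed.

Lemma integral_expRN_itvcy {R : realType} (s : R) :
  (\int[lebesgue_measure]_(t in `[s, +oo[) (expR (- t))%:E = (expR (- s))%:E)%E.
Proof.
have dF (t : R) : is_derive t 1 (fun x : R => - expR (- x)) (expR (- t)).
  by apply: is_derive_eq; rewrite mulrN1 opprK.
have cF (t : R) : {for t, continuous (fun x : R => - expR (- x))}.
  by apply: differentiable_continuous; apply/derivable1_diffP.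
rewrite (@ge0_continuous_FTC2y _ _ (fun x => - expR (- x)) _ 0).
- by rewrite -EFinB opprK add0r.
- by move=> x _; exact: expR_ge0.
- apply: continuous_subspaceT => x.
  by apply: differentiable_continuous; apply/derivable1_diffP.
- by rewrite -oppr0; apply: cvgN; exact: cvgr_expR.
- by move=> x _; apply: ex_derive; exact: dF.
- by apply: cvg_at_right_filter; exact: cF.
- by move=> x _; rewrite derive1E derive_val.
Qed.

(** The double integral of s^(p-1) e^(-t) over the region [D] is computed in both orders. The
    identity lives in the extended reals, so it is available for proving finiteness. *)
Lemma integral_Gamma_rec {R : realType} (p : R) : 0 < p ->
  (\int[lebesgue_measure]_(t in `[0%R, +oo[) (t `^ p * expR (- t))%:E =
   p%:E * \int[lebesgue_measure]_(t in `[0%R, +oo[)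
     (t `^ (p - 1) * expR (- t))%:E)%E.
Proof.
move=> p0.
pose D : set (R * R) := [set z | 0 <= z.1 <= z.2].
pose h (z : R * R) : \bar R := (z.1 `^ (p - 1) * expR (- z.2))%:E.
have h0 z : (0 <= h z)%E by rewrite lee_fin mulr_ge0 ?powR_ge0 ?expR_ge0.
have DE x y : ((x, y) \in D) = (0 <= x <= y) by apply/idP/idP; rewrite inE.
have mD : measurable D.
  rewrite (_ : D = [set z | 0 <= z.1] `&` [set z | z.1 <= z.2]); last first.
    by apply/seteqP; split => z /=; [move/andP|move=> [? ?]; apply/andP].
  apply: measurableI; rewrite -[X in measurable X]setTI.
    by apply: measurable_fun_le.
  by apply: measurable_fun_le.
have mh : measurable_fun setT h.
  apply/measurable_EFinP; apply: measurable_funM.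
    by apply: measurableT_comp (measurable_powR _) _.
  by do 2 (apply: measurableT_comp => //); exact: measurable_oppr.
have mg : measurable_fun setT (h \_ D).
  by apply/(measurable_restrictT h) => //; exact: measurable_funTS.
have g0 z : (0 <= (h \_ D) z)%E by apply: erestrict_ge0.
have /= :=
  fubini_tonelli (m1 := lebesgue_measure) (m2 := lebesgue_measure) _ mg g0.
(* For fixed [x], the tail of the exponential over [[x, +oo[] is e^(-x), which yields the integrand
   on the right-hand side. *)
have -> : (fun x : R => \int[lebesgue_measure]_y (h \_ D) (x, y))%E =
    (fun x => (x `^ (p - 1) * expR (- x))%:E) \_ `[0, +oo[.
  apply/funext => x; rewrite patchE mem_setE in_itv/= andbT.
  case: (leP 0 x) => x0; last first.
    rewrite integral0_eq// => y _; rewrite patchE memNset//= => /andP[].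
    by rewrite leNgt x0.
  transitivity (\int[lebesgue_measure]_y
      ((fun y : R => (x `^ (p - 1))%:E * (expR (- y))%:E) \_ `[x, +oo[) y)%E.
    apply: eq_integral => y _; rewrite !patchE DE mem_setE in_itv/= x0/= andbT.
    by rewrite /h/= EFinM.
  rewrite -integral_mkcond ge0_integralZl//=.
  - by rewrite integral_expRN_itvcy EFinM.
  - by apply/measurable_EFinP; exact: measurable_expRN.
  - by rewrite lee_fin powR_ge0.
(* For fixed [y], the power integrated over [[0, y]] is y^p / p, which yields the integrand on the
   left-hand side up to the factor 1/p. *)
have -> : (fun y : R => \int[lebesgue_measure]_x (h \_ D) (x, y))%E =
    (fun y => (p^-1 * (y `^ p * expR (- y)))%:E) \_ `[0, +oo[.
  apply/funext => y; rewrite patchE mem_setE in_itv/= andbT.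
  case: (leP 0 y) => y0; last first.
    rewrite integral0_eq// => x _; rewrite patchE memNset//= => /andP[x0 xy].
    by have := lt_le_trans y0 (le_trans x0 xy); rewrite ltxx.
  transitivity (\int[lebesgue_measure]_x
      ((fun x : R => (expR (- y))%:E * (x `^ (p - 1))%:E) \_ `[0%R, y]) x)%E.
    apply: eq_integral => x _; rewrite !patchE DE mem_setE in_itv/=.
    by rewrite /h/= EFinM muleC.
  rewrite -integral_mkcond ge0_integralZl//=.
  - by rewrite integral_powRB1// -EFinM; congr EFin; rewrite mulrC; ring.
  - apply/measurable_EFinP; apply: measurable_funTS; exact: measurable_powR.
  - by move=> x _; rewrite lee_fin powR_ge0.
rewrite -!integral_mkcond => ->.
under [in RHS]eq_integral do rewrite EFinM.
rewrite ge0_integralZl//=.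
- by rewrite muleA -EFinM divff ?gt_eqF// mul1e.
- exact: measurable_powR_expRN.
- by move=> x _; exact: powR_expRN_ge0.
- by rewrite lee_fin invr_ge0 ltW.
Qed.

Lemma integral_Gamma_lty {R : realType} (p : R) : 0 < p ->
  (\int[lebesgue_measure]_(t in `[0%R, +oo[)
     (t `^ (p - 1) * expR (- t))%:E < +oo)%E.
Proof.
(* The exponent is real, so the induction runs on an integer upper bound for it. *)
suff H n (q : R) : 0 < q <= n.+1%:R ->
    (\int[lebesgue_measure]_(t in `[0%R, +oo[)
     (t `^ (q - 1) * expR (- t))%:E < +oo)%E.
  move=> p0; apply: (H (Num.truncn p)).
  by rewrite p0 ltW// truncnS_gt.
elim: n q => [q /andP[q0 q1]|n IH q /andP[q0 qn]].
  (* Base case, split at 1: on [[0, 1]] the exponential is at most 1 and the power is integrable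
     since [0 < q]; beyond 1 the power is at most 1 since [q <= 1], and the exponential is
     integrable. *)
  have -> : `[0, +oo[%classic = `[0, 1] `|` `]1, +oo[ :> set R.
    by rewrite -itv_bndbnd_setU// bnd_simp.
  rewrite ge0_integral_setU//=; last 3 first.
  - exact: measurable_powR_expRN.
  - by move=> x _; exact: powR_expRN_ge0.
  - apply/disj_setPS => x [] /=; rewrite !in_itv/= => /andP[_ x1] /andP[].
    by rewrite ltNge x1.
  apply: lte_add_pinfty.
    apply: (@le_lt_trans _ _ (1 `^ q / q)%:E); last exact: ltry.
    rewrite -integral_powRB1//; apply: ge0_le_integral => //=.
    - by move=> x _; exact: powR_expRN_ge0.
    - exact: measurable_powR_expRN.
    - apply/measurable_EFinP; apply: measurable_funTS; exact: measurable_powR.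
    - move=> x; rewrite in_itv/= => /andP[x0 _].
      by rewrite lee_fin ler_piMr ?powR_ge0// -expR0 ler_expR oppr_le0.
  apply: (@le_lt_trans _ _ (expR (- 1))%:E); last exact: ltry.
  rewrite -integral_expRN_itvcy -[leRHS]integral_itv_obnd_cbnd; last first.
    by apply/measurable_EFinP; exact: measurable_expRN.
  apply: ge0_le_integral => //=.
  - by move=> x _; exact: powR_expRN_ge0.
  - exact: measurable_powR_expRN.
  - by apply/measurable_EFinP; exact: measurable_expRN.
  - move=> x; rewrite in_itv/= andbT => x1.
    rewrite lee_fin ler_piMl ?expR_ge0// -[leRHS](powRr0 x).
    by rewrite ler_powR ?(ltW x1)// subr_le0.
(* The recurrence lowers the exponent to [q - 1], which must stay positive; for [q <= 1] the
   induction hypothesis already covers [q] itself. *)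
have [qle1|qgt1] := leP q 1.
  by apply: IH; rewrite q0 (le_trans qle1)// ler1n.
rewrite integral_Gamma_rec ?subr_gt0//.
rewrite lte_mul_pinfty//; first by rewrite lee_fin subr_ge0 ltW.
by apply: IH; rewrite subr_gt0 qgt1 lerBlDr natr1.
Qed.

(** On [[0, 1]] the exponential is at least e^(-1), so the integral is at least e^(-1) / p. *)
Lemma integral_Gamma_gt0 {R : realType} (p : R) : 0 < p ->
  (0 < \int[lebesgue_measure]_(t in `[0%R, +oo[)
     (t `^ (p - 1) * expR (- t))%:E)%E.
Proof.
move=> p0.
apply: (@lt_le_trans _ _ (expR (- 1) * (1 `^ p / p))%:E).
  by rewrite lte_fin mulr_gt0 ?expR_gt0// divr_gt0 ?powR_gt0.
rewrite EFinM -integral_powRB1// -ge0_integralZl//=; last 2 first.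
- by apply/measurable_EFinP; apply: measurable_funTS; exact: measurable_powR.
- by move=> x _; rewrite lee_fin powR_ge0.
apply: (@le_trans _ _ (\int[lebesgue_measure]_(t in `[0%R, 1%R])
     (t `^ (p - 1) * expR (- t))%:E)%E).
  apply: ge0_le_integral => //=.
  - by move=> x _; rewrite lee_fin mulr_ge0 ?powR_ge0 ?expR_ge0.
  - apply/measurable_EFinP; apply: measurable_funM => //.
    by apply: measurable_funTS; exact: measurable_powR.
  - exact: measurable_powR_expRN.
  - move=> x; rewrite in_itv/= => /andP[_ x1].
    by rewrite lee_fin mulrC ler_wpM2l ?powR_ge0// ler_expR lerN2.
apply: ge0_subset_integral => //=.
- exact: measurable_powR_expRN.
- by move=> x _; exact: powR_expRN_ge0.
- by move=> x /=; rewrite !in_itv/= andbT => /andP[].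
Qed.

(** Finiteness matters here as well: [fine] sends an infinite integral to 0. *)
Lemma Gamma_gt0 {R : realType} (p : R) : 0 < p -> 0 < Gamma p.
Proof.
by move=> p0; apply: fine_gt0; rewrite integral_Gamma_gt0 ?integral_Gamma_lty.
Qed.

Lemma GammaD1 {R : realType} (p : R) : 0 < p -> Gamma (p + 1) = p * Gamma p.
Proof.
move=> p0; rewrite /Gamma /Rintegral addrK integral_Gamma_rec// fineM//.
by rewrite ge0_fin_numE ?integral_Gamma_lty// ltW// integral_Gamma_gt0.
Qed.

(** * Bounds for integrals against the Riemann-Liouville kernels *)

Lemma integral_powR_subr {R : realType} (p a d : R) : 0 < p -> a <= d ->
  (\int[lebesgue_measure]_(t in `[a, d]) ((d - t) `^ (p - 1))%:E =
   ((d - a) `^ p / p)%:E)%E.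
Proof.
move=> p0 ad; rewrite -integral_powRB1 ?subr_ge0//.
rewrite [RHS](ge0_integral_reflection d)//=.
- rewrite (_ : _ @^-1` _ = `[a, d]%classic)//.
  by apply/seteqP; split => x /=; rewrite !in_itv/= => /andP[]; lra.
- by apply/measurable_EFinP; apply: measurable_funTS; exact: measurable_powR.
- by move=> x _; rewrite lee_fin powR_ge0.
Qed.

(** The estimate is made on extended integrals of nonnegative functions, where reflection and
    additivity are free; the upper bound then gives the finiteness needed to return to real
    integrals. *)
Lemma Rintegral_RL_kernels_bounds {R : realType} (p a d : R) (f : R -> R) :
  0 < p -> a <= d -> measurable_fun `[a, d] f ->
  {in `[a, d], forall x, 0 <= f x} ->
  {in `[a, d], forall x,
    2 * f ((a + d) / 2) <= f x + f (a + d - x) <= f a + f d} ->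
  2 * f ((a + d) / 2) * ((d - a) `^ p / p) <=
    Rintegral lebesgue_measure `[a, d] (fun t => (d - t) `^ (p - 1) * f t) +
    Rintegral lebesgue_measure `[a, d] (fun t => (t - a) `^ (p - 1) * f t)
  <= (f a + f d) * ((d - a) `^ p / p).
Proof.
move=> p0 ad mf f0 fP.
have rI x : x \in `[a, d] -> a + d - x \in `[a, d].
  by rewrite !in_itv/= => /andP[xa xd]; apply/andP; split; lra.
have mk : measurable_fun `[a, d] (fun t : R => (d - t) `^ (p - 1)).
  apply: measurable_funTS; apply: (measurableT_comp (measurable_powR _)).
  exact: measurable_reflection.
have mk' : measurable_fun `[a, d] (fun t : R => (t - a) `^ (p - 1)).
  apply: measurable_funTS; apply: (measurableT_comp (measurable_powR _)).
  exact: measurable_funB.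
have mf' : measurable_fun `[a, d] (fun t => f (a + d - t)).
  apply: (measurable_comp (F := `[a, d]%classic)) => //.
    by move=> _ [x + <-] /=; exact: rI.
  by apply: measurable_funTS; exact: measurable_reflection.
have m0 : 0 <= f ((a + d) / 2).
  by apply: f0; rewrite in_itv/=; apply/andP; split; lra.
have a0 : 0 <= f a by apply: f0; rewrite in_itv/= lexx.
have d0 : 0 <= f d by apply: f0; rewrite in_itv/= lexx andbT.
set I1 := Rintegral _ _ _; set I2 := Rintegral _ _ _.
pose J1 := (\int[lebesgue_measure]_(t in `[a, d])
  ((d - t) `^ (p - 1) * f t)%:E)%E.
pose J2 := (\int[lebesgue_measure]_(t in `[a, d])
  ((t - a) `^ (p - 1) * f t)%:E)%E.
(* Reflection about the centre turns the kernel at [a] into the kernel at [d], so both integrals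
   share one weight. *)
have J2E : J2 = (\int[lebesgue_measure]_(t in `[a, d])
  ((d - t) `^ (p - 1) * f (a + d - t))%:E)%E.
  rewrite /J2 ge0_integral_reflection_itv; first last.
  - by move=> x xI; rewrite lee_fin mulr_ge0 ?powR_ge0 ?f0.
  - by apply/measurable_EFinP; exact: measurable_funM.
  by apply: eq_integral => x _; congr (_ `^ _ * _)%:E; ring.
have J12 : (J1 + J2 = \int[lebesgue_measure]_(t in `[a, d])
  ((d - t) `^ (p - 1) * (f t + f (a + d - t))%R)%:E)%E.
  rewrite J2E -ge0_integralD//=.
  - by apply: eq_integral => x _; rewrite -EFinD -mulrDr.
  - by move=> x xI; rewrite lee_fin mulr_ge0 ?powR_ge0 ?f0.
  - by apply/measurable_EFinP; exact: measurable_funM.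
  - by move=> x xI; rewrite lee_fin mulr_ge0 ?powR_ge0 ?f0 ?rI.
  - by apply/measurable_EFinP; exact: measurable_funM.
have intk (c : R) : 0 <= c -> (\int[lebesgue_measure]_(t in `[a, d])
    ((d - t) `^ (p - 1) * c)%:E = (c * ((d - a) `^ p / p))%:E)%E.
  move=> c0; under eq_integral do rewrite mulrC EFinM.
  rewrite ge0_integralZl//= ?integral_powR_subr//.
    by apply/measurable_EFinP.
  by move=> x _; rewrite lee_fin powR_ge0.
have JP : ((2 * f ((a + d) / 2) * ((d - a) `^ p / p))%:E <= J1 + J2 <=
    ((f a + f d) * ((d - a) `^ p / p))%:E)%E.
  rewrite J12 -(intk _ (mulr_ge0 (ler0n _ 2) m0)) -(intk _ (addr_ge0 a0 d0)).
  apply/andP; split; apply: ge0_le_integral => //=.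
  - by move=> x xI; rewrite lee_fin mulr_ge0 ?powR_ge0 ?mulr_ge0.
  - by apply/measurable_EFinP; exact: measurable_funM.
  - apply/measurable_EFinP; apply: measurable_funM => //.
    exact: measurable_funD.
  - by move=> x /fP/andP[fl _]; rewrite lee_fin ler_wpM2l ?powR_ge0.
  - by move=> x xI; rewrite lee_fin mulr_ge0 ?powR_ge0 ?addr_ge0 ?f0 ?rI.
  - apply/measurable_EFinP; apply: measurable_funM => //.
    exact: measurable_funD.
  - by apply/measurable_EFinP; exact: measurable_funM.
  - by move=> x /fP/andP[_ fu]; rewrite lee_fin ler_wpM2l ?powR_ge0.
have J10 : (0 <= J1)%E.
  by apply: integral_ge0 => x xI; rewrite lee_fin mulr_ge0 ?powR_ge0 ?f0.
have J20 : (0 <= J2)%E.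
  by apply: integral_ge0 => x xI; rewrite lee_fin mulr_ge0 ?powR_ge0 ?f0.
(* The sum is below a real number; as both terms are nonnegative, each is finite. *)
have /andP[_ /le_lt_trans/(_ (ltry _)) J12y] := JP.
have J1fin : J1 \is a fin_num.
  by rewrite ge0_fin_numE// (le_lt_trans _ J12y)// leeDl.
have J2fin : J2 \is a fin_num.
  by rewrite ge0_fin_numE// (le_lt_trans _ J12y)// leeDr.
rewrite (_ : I1 = fine J1)// (_ : I2 = fine J2)//.
by rewrite -!lee_fin EFinD !fineK.
Qed.

(** * Condition C and preinvexity along a segment *)

Section conditionC_segment.
Context {R : realType} (A : set R) (eta : R -> R -> R) (f : R -> R) (a b : R).
Hypotheses (inv : invex A eta) (condC : conditionC A eta) (Aa : A a) (Ab : A b).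
Local Notation u t := (a + t * eta b a).

(** The second identity of Condition C gives [eta b (u s) = (1 - s) * eta b a]. Hence moving from
    [u s] towards [b] with parameter (t - s)/(1 - s) reaches [u t], and the first identity based at
    [u s] gives the value. *)
Lemma conditionC_segment (s t : R) : 0 <= s -> s <= t -> t <= 1 ->
  eta (u s) (u t) = - ((t - s) * eta b a).
Proof.
move=> s0 st t1.
have s01 : 0 <= s <= 1 by rewrite s0 (le_trans st).
have Aus : A (u s) by exact: inv.
move: st; rewrite le_eqVlt => /predU1P[<-|st].
  (* Parameter 0 gives [eta (u s) (u s) = 0]. Once [s = t] is set aside, [s < 1] and the division by
     [1 - s] is legitimate. *)
  have [] := condC a (u s) Aa Aus 0; first by rewrite lexx ler01.
  by rewrite !mul0r addr0 subrr mul0r.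
have s1 : 0 < 1 - s by rewrite subr_gt0 (lt_le_trans st).
have [_ eta_s] := condC b a Ab Aa s s01.
have [] := condC b (u s) Ab Aus ((t - s) / (1 - s)).
  apply/andP; split; first by rewrite divr_ge0 ?(ltW s1)// subr_ge0 ltW.
  by rewrite ler_pdivrMr// mul1r lerD2r.
have -> : (t - s) / (1 - s) * eta b (u s) = (t - s) * eta b a.
  by rewrite eta_s; field; rewrite gt_eqF.
by rewrite -addrA -mulrDl subrKC.
Qed.

Hypothesis finv : preinvex A eta f.

Lemma preinvex_midpoint (t : R) : 0 <= t <= 1 ->
  2 * f ((a + u 1) / 2) <= f (u t) + f (u (1 - t)).
Proof.
(* The claim is symmetric under [t] and [1 - t], while [conditionC_segment] requires ordered
   parameters. *)
wlog t2 : t / t <= 1 - t.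
  move=> H t01; have [|t2] := leP t (1 - t); first by move/H; apply.
  have : 2 * f ((a + u 1) / 2) <= f (u (1 - t)) + f (u (1 - (1 - t))).
    by apply: H; lra.
  by rewrite subKr; lra.
move=> /andP[t0 t1].
have t01 : 0 <= t <= 1 by rewrite t0.
have t01' : 0 <= 1 - t <= 1 by lra.
have h01 : 0 <= (1 / 2 : R) <= 1 by lra.
(* Preinvexity with parameter 1/2, going from [u (1 - t)] back towards [u t], lands on the centre of
   the segment. *)
have := finv _ _ (inv _ _ Aa Ab _ t01') (inv _ _ Aa Ab _ t01) _ h01.
rewrite conditionC_segment//; last by lra.
rewrite (_ : u (1 - t) + _ = (a + u 1) / 2); last by field.
lra.
Qed.

(** Preinvexity from [a] towards [b] would bring in [f b]. To obtain the endpoint value [f (u 1)],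
    the direction is taken towards [u 1], which is the same because [eta (u 1) a = eta b a]. *)
Lemma preinvex_chord (t : R) : 0 <= t <= 1 ->
  f (u t) <= (1 - t) * f a + t * f (u 1).
Proof.
move=> t01.
have Ad : A (u 1) by apply: inv; rewrite ?ler01 ?lexx.
have eta_ad : eta a (u 1) = - eta b a.
  by have := @conditionC_segment 0 1; rewrite mul0r addr0 subr0 mul1r; apply.
(* Condition C at parameter 1 based at [u 1]: moving by [eta a (u 1)] leads back to [a]. *)
have eta_da : eta (u 1) a = eta b a.
  have [] := condC a (u 1) Aa Ad 1; first by rewrite ler01 lexx.
  by rewrite eta_ad !mul1r opprK addrK.
by have := finv a (u 1) Aa Ad t t01; rewrite eta_da.
Qed.

End conditionC_segment.

(** * The fractional Hermite-Hadamard inequality for preinvex functions *)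

Theorem theorem2p1 (R : realType) (A : set R) (eta : R -> R -> R)
  (f : R -> R) (a b alpha : R) :
  open A -> invex A eta -> conditionC A eta ->
  A a -> A b -> a < a + eta b a ->
  (forall x, A x -> 0 < f x) -> preinvex A eta f ->
  (@lebesgue_measure R).-integrable `[a, a + eta b a] (EFin \o f) ->
  0 < alpha ->
  f ((2 * a + eta b a) / 2)
    <= Gamma (alpha + 1) / (2 * (eta b a) `^ alpha) *
       (RL_left alpha a f (a + eta b a) + RL_right alpha (a + eta b a) f a)
  /\ Gamma (alpha + 1) / (2 * (eta b a) `^ alpha) *
       (RL_left alpha a f (a + eta b a) + RL_right alpha (a + eta b a) f a)
     <= (f a + f (a + eta b a)) / 2
  /\ (f a + f (a + eta b a)) / 2 <= (f a + f b) / 2.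
Proof.
move=> _ inv condC Aa Ab ltad f_gt0 finv intf alpha0.
have e0 : 0 < eta b a by rewrite ltrDl in ltad.
have uP x : x \in `[a, a + eta b a] ->
    exists2 t, 0 <= t <= 1 & x = a + t * eta b a.
  rewrite in_itv/= => /andP[ax xd]; exists ((x - a) / eta b a).
    by rewrite divr_ge0 ?subr_ge0 ?(ltW e0)//= ler_pdivrMr// mul1r lerBlDl.
  by rewrite divfK ?gt_eqF// subrKC.
have mf : measurable_fun `[a, a + eta b a] f.
  by case/integrableP: intf => /measurable_EFinP.
have := @Rintegral_RL_kernels_bounds R alpha a (a + eta b a) f alpha0
  (ltW ltad) mf.
case/(_ _ _)/andP.
- by move=> x /uP[t t01 ->]; apply/ltW/f_gt0/inv.
- move=> x /uP[t t01 ->].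
  rewrite (_ : a + (a + eta b a) - _ = a + (1 - t) * eta b a); last by ring.
  (* The lower bound is midpoint convexity; the upper bound adds the chord inequalities at [t] and
     [1 - t], whose weights sum to 1 at each endpoint. *)
  have mid := preinvex_midpoint A eta f a b inv condC Aa Ab finv t t01.
  have c1 := preinvex_chord A eta f a b inv condC Aa Ab finv t t01.
  have t01' : 0 <= 1 - t <= 1 by lra.
  have c2 := preinvex_chord A eta f a b inv condC Aa Ab finv (1 - t) t01'.
  by rewrite !mul1r in mid c1 c2; apply/andP; split; lra.
rewrite /RL_left /RL_right GammaD1//.
set I1 := Rintegral _ _ _; set I2 := Rintegral _ _ _.
rewrite (_ : a + (a + eta b a) = 2 * a + eta b a); last by ring.
rewrite (_ : a + eta b a - a = eta b a); last by ring.
have G0 := Gamma_gt0 alpha alpha0.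
have E0 : 0 < eta b a `^ alpha by exact: powR_gt0.
set G := Gamma alpha in G0 *; set E := eta b a `^ alpha in E0 *.
(* The Gamma factors cancel, leaving division by twice [E / alpha], the total mass of the kernel. *)
rewrite (_ : alpha * G / (2 * E) * (G^-1 * I1 + G^-1 * I2) =
  (I1 + I2) / (2 * (E / alpha))); last first.
  by field; rewrite !gt_eqF.
have K0 : 0 < 2 * (E / alpha) by rewrite mulr_gt0// divr_gt0.
move=> lo hi; split; last split.
- rewrite ler_pdivlMr//; apply: le_trans lo; lra.
- rewrite ler_pdivrMr//; apply: (le_trans hi); lra.
(* Preinvexity at parameter 1 says [f (a + eta b a) <= f b]. *)
- have := finv a b Aa Ab 1; rewrite ler01 lexx mul1r => /(_ isT); lra.
Qed.
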